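(* Let $G$ be a (possibly infinite) group and let $C_1,\ldots,C_n$ be cosets of subgroups of $G$, where each $C_i$ may be a left coset or a right coset. Suppose that $A:=G\setminus(C_1\cup\ldots\cup C_n)\neq\varnothing$. Then there exist an integer $m\le 2^n$ and elements $t_1,\ldots,t_m\in G$ such that $G=t_1A\cup\ldots\cup t_mA$.
   Context: For $t\in G$ and $A\subseteq G$, $tA:=\{ta: a\in A\}$ denotes the left translate of $A$ by $t$. The subgroups involved are arbitrary; different $C_i$ may be cosets of different subgroups. $n$ is a positive integer. *)

(* Defs.v *)
From HB Require Import structures.
From mathcomp Require Import all_boot.
From mathcomp Require Import boolp classical_sets.

Set Implicit Arguments.
Unset Strict Implicit.
Unset Printing Implicit Defensive.

Local Open Scope classical_set_scope.
Local Open Scope group_scope.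

(* Subsets of G are arbitrary Prop-valued sets. Restricting G to groupType,
   whose carriers are choice types, excludes no group: classically every type
   can be equipped with a choice structure. *)

Definition is_subgroup (G : groupType) (H : set G) : Prop :=
  group_closed (mem H).

Definition ltranslate (G : groupType) (t : G) (A : set G) : set G :=
  [set t * a | a in A].

Definition rtranslate (G : groupType) (A : set G) (t : G) : set G :=
  [set a * t | a in A].

Definition is_left_coset (G : groupType) (C : set G) : Prop :=
  exists (H : set G) (g : G), is_subgroup H /\ C = ltranslate g H.

Definition is_right_coset (G : groupType) (C : set G) : Prop :=
  exists (H : set G) (g : G), is_subgroup H /\ C = rtranslate H g.

(* Main.v *)
(* Membership of s^-1 y in a left or right coset of H says that two left cosets
   of H, one depending on y only and one on s only, coincide.  If more than 2^n
   translates of A were needed, a greedy choice would give y_0, y_1, ... and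
   t_0, t_1, ... (more than 2^n of each) with y_j in t_j A but y_j outside t_l A
   for l < j.  Such a family is a skew Bollobas system in a product of n sets;
   its size is at most 2^n because, after coding cosets by numbers, the matrix
   prod_i (a_i(j) - b_i(l)) is triangular with nonzero diagonal, while expanding
   the product shows that its rank is at most 2^n. *)
Require Import Defs.
From mathcomp Require Import all_boot all_algebra.
From mathcomp Require Import boolp classical_sets.
Local Open Scope classical_set_scope.
Local Open Scope group_scope.

Section SkewBollobas.
Local Open Scope ring_scope.
Import GRing.Theory Num.Theory.

(** Expanding the product, each subset [S] of ['I_n] takes [a i j] for [i] in [S] and [- b i l]
    elsewhere. This splits every term into a factor in [l] and a factor in [j], so the matrix
    factors through dimension [2 ^ n]. *)
Lemma rank_prod_sub (F : fieldType) (n p q : nat)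
    (a : 'I_n -> 'I_q -> F) (b : 'I_n -> 'I_p -> F) :
  (\rank (\matrix_(l < p, j < q) \prod_(i < n) (a i j - b i l))%R <= 2 ^ n)%N.
Proof.
pose N := #|{set 'I_n}|.
have -> : (2 ^ n)%N = N.
  by rewrite /N -cardsT -powersetT card_powerset cardsT card_ord.
pose P := \matrix_(l < p, k < N)
  \prod_(i < n) (if i \in (enum_val k : {set 'I_n}) then 1 else - b i l).
pose Q := \matrix_(k < N, j < q)
  \prod_(i < n) (if i \in (enum_val k : {set 'I_n}) then a i j else 1).
suff -> : \matrix_(l < p, j < q) \prod_(i < n) (a i j - b i l) = P *m Q.
  exact: leq_trans (mxrankM_maxl _ _) (rank_leq_col _).
apply/matrixP => l j; rewrite !mxE bigA_distr /=.
rewrite (reindex_onto (enum_val : 'I_N -> {set 'I_n}) enum_rank) /=; last first.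
  by move=> S _; rewrite enum_rankK.
rewrite (eq_bigl xpredT); last by move=> k; rewrite enum_valK eqxx.
apply: eq_bigr => k _; rewrite !mxE -big_split /=.
by apply: eq_bigr => i _; case: ifP; rewrite ?mul1r ?mulr1.
Qed.

Lemma skew_bollobas_product (X : eqType) (n m : nat)
    (x z : 'I_n -> 'I_m -> X) :
  (forall i j, x i j <> z i j) ->
  (forall l j : 'I_m, (l < j)%N -> exists i, x i j = z i l) ->
  (m <= 2 ^ n)%N.
Proof.
move=> xzN xzE.
(* Any value not among the z i l receives the code m, hence stays distinct. *)
pose code i u : rat := (index u [seq z i l | l : 'I_m])%:R.
have code_inj i u l : code i u = code i (z i l) -> u = z i l.
  move/eqP; rewrite eqr_nat => /eqP idx_eq.
  have zs : z i l \in [seq z i l | l : 'I_m] by exact: codom_f.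
  (* The index of a listed value is below the length, so [u] is not coded by the default. *)
  have us : u \in [seq z i l | l : 'I_m] by rewrite -index_mem idx_eq index_mem.
  exact: index_inj us zs idx_eq.
pose M := \matrix_(l < m, j < m)
  \prod_(i < n) (code i (x i j) - code i (z i l)).
suff <- : \rank M = m by exact: rank_prod_sub.
apply: mxrank_unit; rewrite unitmxE det_trig; last first.
  apply/is_trig_mxP => l j /xzE[i xz]; rewrite mxE.
  by rewrite (bigD1 i) //= xz subrr mul0r.
rewrite unitfE; apply/prodf_neq0 => j _; rewrite mxE.
apply/prodf_neq0 => i _; rewrite subr_eq0; apply/eqP => /code_inj.
exact: xzN.
Qed.

End SkewBollobas.

Lemma ltranslateP (G : groupType) (t x : G) (A : set G) :
  ltranslate t A x <-> A (t^-1 * x).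
Proof.
split=> [[a Aa <-]|Atx]; first by rewrite mulKg.
by exists (t^-1 * x) => //; rewrite mulVKg.
Qed.

Lemma rtranslateP (G : groupType) (t x : G) (A : set G) :
  rtranslate A t x <-> A (x * t^-1).
Proof.
split=> [[a Aa <-]|Atx]; first by rewrite mulgK.
by exists (x * t^-1) => //; rewrite mulgVK.
Qed.

Lemma eq_ltranslate_subgroup (G : groupType) (H : set G) (x y : G) :
  is_subgroup H -> (ltranslate x H = ltranslate y H) <-> H (y^-1 * x).
Proof.
move=> sH; have [H1 _] := sH.
have HM u v : H u -> H v -> H (u * v).
  by move=> Hu Hv; apply/set_mem/(group_closedM sH); apply: mem_set.
have HV u : H u -> H u^-1.
  by move=> Hu; apply/set_mem/(group_closedV sH); apply: mem_set.
split=> [xyH|Hyx].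
  apply/ltranslateP; rewrite -xyH; apply/ltranslateP.
  by rewrite mulVg; apply/set_mem.
apply/seteqP; split=> w /ltranslateP Hw; apply/ltranslateP.
  by move: (HM _ _ Hyx Hw); rewrite -mulgA mulVKg.
by move: (HM _ _ (HV _ Hyx) Hw); rewrite invgM invgK -mulgA mulVKg.
Qed.

(** For [C = gH] compare [yH] with [tgH]; for [C = Hg] compare [y g^-1 H] with [tH]. Left cosets of
    [H] serve in both cases. *)
Lemma coset_separation (G : groupType) (C : set G) :
  is_left_coset C \/ is_right_coset C ->
  exists f : (G -> set G) * (G -> set G),
    forall t y, C (t^-1 * y) <-> f.1 y = f.2 t.
Proof.
case=> [[H [g [sH ->]]]|[H [g [sH ->]]]].
  exists (fun y => ltranslate y H, fun t => ltranslate (t * g) H) => t y /=.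
  by rewrite eq_ltranslate_subgroup // ltranslateP invgM mulgA.
exists (fun y => ltranslate (y * g^-1) H, fun t => ltranslate t H) => t y /=.
by rewrite eq_ltranslate_subgroup // rtranslateP mulgA.
Qed.

Lemma greedy_translates (G : groupType) (A : set G) (N : nat) :
  A <> set0 ->
  (forall (m : nat) (t : 'I_m -> G), (m <= N)%N ->
     [set: G] <> \bigcup_(j : 'I_m) ltranslate (t j) A) ->
  forall k, (k <= N.+1)%N -> exists y t : nat -> G,
    (forall j, (j < k)%N -> A ((t j)^-1 * y j)) /\
    (forall l j, (l < j < k)%N -> ~ A ((t l)^-1 * y j)).
Proof.
move=> /eqP /set0P[a Aa] noCover; elim=> [_|k IHk lekN].
  (* Values at indices from [k] on are dummies. *)
  by exists (fun=> 1), (fun=> 1); split=> // l j; rewrite ltn0 andbF.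
have [y [t [Ayt nAyt]]] := IHk (ltnW lekN).
have [x xN] : exists x, forall l, (l < k)%N -> ~ A ((t l)^-1 * x).
  apply: contrapT => /forallNP all_in.
  apply: (noCover k (fun j : 'I_k => t j) lekN).
  apply/esym/seteqP; split=> // x _; apply: contrapT => xU.
  apply: (all_in x) => l lk Alx; apply: xU.
  by exists (Ordinal lk) => //; apply/ltranslateP.
exists (fun j => if j == k then x else y j).
(* The new translate is chosen so that [(t k)^-1 * x = a], which lies in [A]. *)
exists (fun j => if j == k then x * a^-1 else t j); split=> [j|l j].
  rewrite ltnS leq_eqVlt; case: eqP => [_ _|_ /= /Ayt //].
  by rewrite invgM invgK mulgVK.
case/andP=> lj; rewrite ltnS leq_eqVlt.
case: (eqVneq j k) => [jk _|_ /= jk].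
  by rewrite jk in lj; rewrite ltn_eqF //; apply: xN.
by rewrite (ltn_eqF (ltn_trans lj jk)); apply: nAyt; rewrite lj.
Qed.

Theorem theorem1 (G : groupType) (n : nat) (hn : (0 < n)%N)
    (C : 'I_n -> set G)
    (hC : forall i : 'I_n, is_left_coset (C i) \/ is_right_coset (C i))
    (A : set G) (hA : A = [set: G] `\` \bigcup_(i : 'I_n) C i)
    (hA0 : A <> set0) :
  exists (m : nat) (t : 'I_m -> G),
    (m <= 2 ^ n)%N /\ [set: G] = \bigcup_(j : 'I_m) ltranslate (t j) A.
Proof.
apply: contrapT => noCover.
have [f fP] := choice (fun i => coset_separation G (C i) (hC i)).
have [|y [t [Ayt nAyt]]] := greedy_translates G A (2 ^ n) hA0 _ _ (leqnn _).
  by move=> m t lem eqG; apply: noCover; exists m, t.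
have := @skew_bollobas_product (set G) n (2 ^ n).+1
  (fun i j => (f i).1 (y j)) (fun i j => (f i).2 (t j)).
rewrite ltnn => bollobas; suff: false by [].
(* Diagonal: [(t j)^-1 * y j] is in [A], so it avoids every [C i]. For [l < j]: [(t l)^-1 * y j] is
   outside [A], so some [C i] contains it. *)
apply: bollobas => [i j /fP Cij|l j lj].
  by move: (Ayt j (ltn_ord j)); rewrite hA => -[_]; apply; exists i.
apply: contrapT => /forallNP fN.
apply: (nAyt l j); first by rewrite lj ltn_ord.
by rewrite hA; split=> // -[i _ /fP]; apply: fN.
Qed.
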